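(* Let $A$ be a Banach algebra with product $\pi$, let $(\pi_{1},X,\pi_{2})$ be a Banach $A$-module and let $D:A\times A\times A\to X$ be a tri-derivation. Then $D^{****}:(A^{**},\square)\times(A^{**},\square)\times(A^{**},\square)\to X^{**}$ is a tri-derivation (with respect to the $(A^{**},\square)$-module $(\pi_1^{***},X^{**},\pi_2^{***})$) if and only if $$\varphi_{a}^{r****r}=\varphi_{a}^{i****i}=\varphi_{a}^{s****t}\quad\text{for every } a\in A$$ and $$\psi_{x^{*}}^{j****j}=\psi_{x^{*}}^{t****s}=\psi_{x^{*}}^{****}\quad\text{for every } x^{*}\in X^{*}.$$
   Context: Adjoint of a tri-linear map: for a bounded tri-linear map $g:E_1\times E_2\times E_3\to E$ of normed spaces, its adjoint is the bounded tri-linear map $g^{*}:E^{*}\times E_1\times E_2\to E_3^{*}$, $\langle g^{*}(e^{*},e_1,e_2),e_3\rangle=\langle e^{*},g(e_1,e_2,e_3)\rangle$; iterating four times gives $g^{****}:E_1^{**}\times E_2^{**}\times E_3^{**}\to E^{**}$. Flips: $g^{i}(e_2,e_1,e_3)=g^{j}(e_1,e_3,e_2)=g^{r}(e_3,e_2,e_1)=g^{t}(e_3,e_1,e_2)=g^{s}(e_2,e_3,e_1)=g(e_1,e_2,e_3)$, with $g^{i}:E_2\times E_1\times E_3\to E$, $g^{j}:E_1\times E_3\times E_2\to E$, $g^{r}:E_3\times E_2\times E_1\to E$, $g^{t}:E_3\times E_1\times E_2\to E$, $g^{s}:E_2\times E_3\times E_1\to E$. Superscripts are applied successively from left to right. Adjoint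 of a bilinear map: for bounded bilinear $m:E_1\times E_2\to E$, $m^{*}:E^{*}\times E_1\to E_2^{*}$ is $\langle m^{*}(e^{*},e_1),e_2\rangle=\langle e^{*},m(e_1,e_2)\rangle$; iterating, $m^{***}:E_1^{**}\times E_2^{**}\to E^{**}$. $\square=\pi^{***}$ is the first Arens product on $A^{**}$. Banach $A$-module $(\pi_1,X,\pi_2)$: $X$ is a Banach space and $\pi_1:A\times X\to X$, $\pi_2:X\times A\to X$ are bounded bilinear maps with $\pi_1(\pi(a,b),x)=\pi_1(a,\pi_1(b,x))$, $\pi_2(x,\pi(a,b))=\pi_2(\pi_2(x,a),b)$ and $\pi_1(a,\pi_2(x,b))=\pi_2(\pi_1(a,x),b)$ for all $a,b\in A$, $x\in X$. Tri-derivation: a bounded tri-linear map $D:A\times A\times A\to X$ such that for all $a,b,c,d\in A$: $D(\pi(a,d),b,c)=\pi_2(D(a,b,c),d)+\pi_1(a,D(d,b,c))$; $D(a,\pi(b,d),c)=\pi_2(D(a,b,c),d)+\pi_1(b,D(a,d,c))$; $D(a,b,\pi(c,d))=\pi_2(D(a,b,c),d)+\pi_1(c,D(a,b,d))$. That $D^{****}$ is a tri-derivation means that it satisfies these identities on $A^{**}$ with $\pi,\pi_1,\pi_2$ replaced by $\pi^{***},\pi_1^{***},\pi_2^{***}$. For $a\in A$, $\varphi_a:A\times A\times A\to X$ is the bounded tri-linear map $\varphi_a(c,b,d)=\pi_2(D(a,b,c),d)$. For $x^*\in X^*$, $\psi_{x^*}:A\times A\times A\to A^*$ is the bounded tri-linear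 map $\psi_{x^*}(a,d,b)=D^{*}(\pi_1^{*}(x^*,b),a,d)$, where $D^*:X^*\times A\times A\to A^*$ and $\pi_1^*:X^*\times A\to X^*$. *)

(* Defs.v *)
From HB Require Import structures.
From mathcomp Require Import all_boot all_order all_algebra.
From mathcomp Require Import complex.
From mathcomp Require Import boolp classical_sets functions reals.
From mathcomp Require Import topology normedtype.

Set Implicit Arguments.
Unset Strict Implicit.
Unset Printing Implicit Defensive.

Import Order.TTheory GRing.Theory Num.Theory.
Import numFieldNormedType.Exports.

Local Open Scope classical_set_scope.
Local Open Scope ring_scope.

(* Real and complex scalars, treated uniformly: a [numFieldType] whose real
   elements are order complete.  Up to isomorphism these are exactly the fields
   of real and of complex numbers; the instances below are [R] and [R[i]] for
   [R : realType].  Norms take values in [K], in its real elements. *)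
HB.mixin Record hasRealSup K & Num.NumField K := {
  real_sup_exists : forall S : set K, S !=set0 ->
    (forall x, S x -> x \is Num.real) -> ubound S !=set0 -> supremums S !=set0
}.

#[short(type="rcScalarType")]
HB.structure Definition RCScalar := {K of Num.NumField K & hasRealSup K}.

Section real_scalar.
Variable R : realType.

Fact real_sup_exists_R (S : set R) : S !=set0 ->
  (forall x, S x -> x \is Num.real) -> ubound S !=set0 -> supremums S !=set0.
Proof.
move=> S0 _ Sub; exists (sup S); split; first exact: sup_upper_bound.
by move=> y Sy; exact: ge_sup.
Qed.

HB.instance Definition _ := hasRealSup.Build R real_sup_exists_R.

Fact real_sup_exists_C (S : set R[i]) : S !=set0 ->
  (forall x, S x -> x \is Num.real) -> ubound S !=set0 -> supremums S !=set0.
Proof.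
move=> [s0 Ss0] Sr [M SM].
pose T := [set complex.Re z | z in S].
have T0 : T !=set0 by exists (complex.Re s0), s0.
have TM y : ubound S y -> ubound T (complex.Re y).
  by move=> Sy _ [z Sz <-]; move: (Sy _ Sz); rewrite lecE => /andP[_].
have Im0 z : S z -> complex.Im z = 0.
  by move=> /Sr /complex_realP[k ->].
exists (Complex (sup T) 0); split.
  move=> z Sz; rewrite lecE /= (Im0 _ Sz) eqxx /=.
  apply: sup_upper_bound; last by exists z.
  by split=> //; exists (complex.Re M); exact: TM.
move=> y Sy; rewrite lecE /=; apply/andP; split.
  by move: (Sy _ Ss0); rewrite lecE (Im0 _ Ss0) => /andP[/eqP-> _].
by apply: ge_sup => //; exact: TM.
Qed.

HB.instance Definition _ := hasRealSup.Build R[i] real_sup_exists_C.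

End real_scalar.

Section dual.
Variables (K : rcScalarType) (E : normedModType K).

Definition bounded_functional : {pred E -> K^o} :=
  mem [set f : E -> K^o | linear f /\
                          exists M : K, forall x, `|f x| <= M * `|x|].

Record dual := Dual {
  dual_val :> E -> K^o ;
  dual_valP : dual_val \in bounded_functional }.

HB.instance Definition _ := [isSub for dual_val].
HB.instance Definition _ := [Choice of dual by <:].

Lemma bounded_functional_submod_closed : submod_closed bounded_functional.
Proof.
split=> [|a f g]; rewrite !inE.
  split=> [c x y|]; first by rewrite scaler0 addr0.
  by exists 0 => x; rewrite mul0r normr0.
move=> [fl [M fM]] [gl [N gN]]; split=> [c x y|].
  by rewrite !fctE fl gl !scalerDr !scalerA addrACA mulrC.
exists (`|a| * M + N) => x; rewrite mulrDl -mulrA.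
rewrite (le_trans (ler_normD _ _))// lerD// normrZ.
by rewrite ler_wpM2l.
Qed.

HB.instance Definition _ :=
  GRing.isSubmodClosed.Build K (E -> K^o) bounded_functional
    bounded_functional_submod_closed.
HB.instance Definition _ := [SubChoice_isSubLmodule of dual by <:].

Lemma dualE (f g : dual) : f =1 g -> f = g.
Proof. by move=> fg; apply/val_inj/funext. Qed.

Lemma dual_linear (f : dual) : linear f.
Proof. by have := dual_valP f; rewrite inE => -[]. Qed.

Lemma dual_bounded (f : dual) : exists M : K, forall x, `|f x| <= M * `|x|.
Proof. by have := dual_valP f; rewrite inE => -[]. Qed.

Lemma dual_bounded0 (f : dual) :
  exists2 M : K, 0 <= M & forall x, `|f x| <= M * `|x|.
Proof.
have [M fM] := dual_bounded f; exists `|M| => // x.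
by rewrite -[`|x|]normr_id -normrM ger0_norm// (le_trans _ (fM x)).
Qed.

HB.instance Definition _ (f : dual) :=
  GRing.isLinear.Build K E K^o _ f (@dual_linear f).

Definition dual_norm (f : dual) : K :=
  supremum 0 [set `|f x| | x in [set x | `|x| <= 1]].

Lemma dual_norm_sup (f : dual) :
  supremums [set `|f x| | x in [set x | `|x| <= 1]] (dual_norm f).
Proof.
rewrite /dual_norm /supremum; set S := image _ _.
have S0 : S !=set0 by exists `|f 0|, 0 => //=; rewrite normr0.
case: ifPn => [/eqP SE|_]; first by move/set0P: S0; rewrite SE eqxx.
apply: xgetPex; apply: real_sup_exists => //.
  by move=> _ [x _ <-]; exact: normr_real.
have [M M0 fM] := dual_bounded0 f; exists M => _ [x /= x1 <-].
by rewrite (le_trans (fM x))// ler_piMr.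
Qed.

Lemma le_dual_norm (f : dual) x : `|f x| <= dual_norm f * `|x|.
Proof.
have [ubf _] := dual_norm_sup f.
have [->|x0] := eqVneq x 0; first by rewrite linear0 !normr0 mulr0.
have nx : 0 < `|x| by rewrite normr_gt0.
rewrite -ler_pdivrMr// mulrC.
have <- : `|f (`|x|^-1 *: x)| = `|x|^-1 * `|f x|.
  by rewrite linearZ normrZ normfV normr_id.
apply: ubf; exists (`|x|^-1 *: x) => //=.
by rewrite normrZ normfV normr_id mulVf// gt_eqF.
Qed.

Lemma dual_norm_le (f : dual) M :
  (forall x, `|x| <= 1 -> `|f x| <= M) -> dual_norm f <= M.
Proof.
by move=> fM; have [_] := dual_norm_sup f; apply=> _ [x /= x1 <-]; exact: fM.
Qed.

Lemma dual_norm_ge0 (f : dual) : 0 <= dual_norm f.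
Proof.
have [ubf _] := dual_norm_sup f.
by apply: le_trans (ubf `|f 0| _) => //; exists 0 => //=; rewrite normr0.
Qed.

Lemma dual_normD (f g : dual) : dual_norm (f + g) <= dual_norm f + dual_norm g.
Proof.
apply: dual_norm_le => x x1; rewrite (le_trans (ler_normD _ _))// lerD//.
  by rewrite (le_trans (le_dual_norm _ _))// ler_piMr// dual_norm_ge0.
by rewrite (le_trans (le_dual_norm _ _))// ler_piMr// dual_norm_ge0.
Qed.

Lemma dual_normZ_le (l : K) (f : dual) :
  dual_norm (l *: f) <= `|l| * dual_norm f.
Proof.
apply: dual_norm_le => x x1; rewrite [(l *: f) x]/(l *: f x) normrZ.
rewrite ler_wpM2l// (le_trans (le_dual_norm _ _))// ler_piMr//.
exact: dual_norm_ge0.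
Qed.

Lemma dual_normZ (l : K) (f : dual) : dual_norm (l *: f) = `|l| * dual_norm f.
Proof.
apply/eqP; rewrite eq_le dual_normZ_le /=.
have [->|l0] := eqVneq l 0; first by rewrite normr0 mul0r dual_norm_ge0.
rewrite -ler_pdivlMl ?normr_gt0// -normfV.
by rewrite (le_trans _ (dual_normZ_le _ _))// scalerA mulVf// scale1r.
Qed.

Lemma dual_norm_eq0 (f : dual) : dual_norm f = 0 -> f = 0.
Proof.
move=> f0; apply: dualE => x; apply/eqP.
by rewrite -normr_le0 (le_trans (le_dual_norm _ _))// f0 mul0r.
Qed.

HB.instance Definition _ :=
  Lmodule_isNormed.Build K dual dual_normD dual_normZ dual_norm_eq0.

End dual.

Lemma ler_norm_dual (K : rcScalarType) (E : normedModType K) (f : dual E) x :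
  `|f x| <= `|f| * `|x|.
Proof. exact: le_dual_norm. Qed.

Lemma dualP (K : rcScalarType) (E : normedModType K) (f : E -> K^o) :
  linear f -> (exists M : K, forall x, `|f x| <= M * `|x|) ->
  f \in @bounded_functional K E.
Proof. by move=> fl fM; rewrite inE. Qed.

Lemma le_abs_coef (K : numDomainType) (a M t : K) :
  0 <= a -> 0 <= t -> a <= M * t -> a <= `|M| * t.
Proof.
move=> a0 t0 aMt; have Mt0 := le_trans a0 aMt.
by rewrite -[X in _ * X](ger0_norm t0) -normrM ger0_norm.
Qed.

Record bbilinear (K : rcScalarType) (E1 E2 E : normedModType K) := BBilinear {
  bbil_map :> {bilinear E1 -> E2 -> E};
  bbil_bounded : exists M : K, forall x y,
    `|bbil_map x y| <= M * (`|x| * `|y|) }.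

Record btrilinear (K : rcScalarType) (E1 E2 E3 E : normedModType K) :=
  BTrilinear {
  btri_map :> E1 -> E2 -> E3 -> E;
  btri_linear1 : forall y z, linear (fun x => btri_map x y z);
  btri_linear2 : forall x z, linear (fun y => btri_map x y z);
  btri_linear3 : forall x y, linear (fun z => btri_map x y z);
  btri_bounded : exists M : K, forall x y z,
    `|btri_map x y z| <= M * (`|x| * `|y| * `|z|) }.

Section bounded_multilinear_theory.
Variables (K : rcScalarType) (E1 E2 E3 E : normedModType K).

Lemma bbil_bounded0 (m : bbilinear E1 E2 E) :
  exists2 M : K, 0 <= M & forall x y, `|m x y| <= M * (`|x| * `|y|).
Proof.
have [M mM] := bbil_bounded m; exists `|M| => // x y.
by apply: le_abs_coef; rewrite ?mulr_ge0.
Qed.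

Lemma btri_bounded0 (g : btrilinear E1 E2 E3 E) :
  exists2 M : K, 0 <= M & forall x y z, `|g x y z| <= M * (`|x| * `|y| * `|z|).
Proof.
have [M gM] := btri_bounded g; exists `|M| => // x y z.
by apply: le_abs_coef; rewrite ?mulr_ge0.
Qed.

Lemma btrilinearP (g h : btrilinear E1 E2 E3 E) :
  (forall x y z, g x y z = h x y z) -> g = h.
Proof.
move=> gh; have {}gh : btri_map g = btri_map h.
  by apply/funext => x; apply/funext => y; apply/funext => z; exact: gh.
case: g h gh => [g g1 g2 g3 gb] [h h1 h2 h3 hb] /= gh; subst h.
by congr BTrilinear; exact: Prop_irrelevance.
Qed.

End bounded_multilinear_theory.

Section adjoint2.
Variables (K : rcScalarType) (E1 E2 E : normedModType K).
Variable m : bbilinear E1 E2 E.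

Fact adj2_dual (f : dual E) (x : E1) :
  (fun y => f (m x y)) \in @bounded_functional K E2.
Proof.
apply: dualP => [c y z|]; first by rewrite linearPr linearP.
have [M M0 mM] := bbil_bounded0 m.
exists (`|f| * (M * `|x|)) => y.
by rewrite (le_trans (ler_norm_dual _ _))// -!mulrA ler_wpM2l.
Qed.

Definition adj2_map (f : dual E) (x : E1) : dual E2 :=
  @Dual K E2 (fun y => f (m x y)) (adj2_dual f x).

Fact adj2_bilinear : bilinear_for *:%R *:%R adj2_map.
Proof.
split=> [x c f g|f c x y]; apply: dualE => z //=.
by rewrite /= linearPl linearP.
Qed.

HB.instance Definition _ := bilinear_isBilinear.Build K (dual E) E1 (dual E2)
  _ _ adj2_map adj2_bilinear.

Fact adj2_bounded : exists M : K, forall f x,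
  `|adj2_map f x| <= M * (`|f| * `|x|).
Proof.
have [M M0 mM] := bbil_bounded0 m; exists M => f x.
apply: dual_norm_le => y y1 /=.
rewrite (le_trans (ler_norm_dual _ _))// mulrCA ler_wpM2l//.
rewrite (le_trans (mM _ _))// ler_wpM2l//.
by rewrite ler_piMr.
Qed.

Definition adj2 : bbilinear (dual E) E1 (dual E2) := BBilinear adj2_bounded.

End adjoint2.

Section adjoint3.
Variables (K : rcScalarType) (E1 E2 E3 E : normedModType K).
Variable g : btrilinear E1 E2 E3 E.

Fact adj3_dual (f : dual E) (x : E1) (y : E2) :
  (fun z => f (g x y z)) \in @bounded_functional K E3.
Proof.
apply: dualP => [c z t|]; first by rewrite btri_linear3 linearP.
have [M M0 gM] := btri_bounded0 g.
exists (`|f| * (M * (`|x| * `|y|))) => z.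
by rewrite (le_trans (ler_norm_dual _ _))// -mulrA ler_wpM2l// -mulrA.
Qed.

Definition adj3_map (f : dual E) (x : E1) (y : E2) : dual E3 :=
  @Dual K E3 (fun z => f (g x y z)) (adj3_dual f x y).

Fact adj3_linear1 x y : linear (fun f => adj3_map f x y).
Proof. by move=> c f h; apply: dualE. Qed.

Fact adj3_linear2 f y : linear (fun x => adj3_map f x y).
Proof.
by move=> c x x'; apply: dualE => z /=; rewrite btri_linear1 linearP.
Qed.

Fact adj3_linear3 f x : linear (fun y => adj3_map f x y).
Proof.
by move=> c y y'; apply: dualE => z /=; rewrite btri_linear2 linearP.
Qed.

Fact adj3_bounded : exists M : K, forall f x y,
  `|adj3_map f x y| <= M * (`|f| * `|x| * `|y|).
Proof.
have [M M0 gM] := btri_bounded0 g; exists M => f x y.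
apply: dual_norm_le => z z1 /=.
rewrite (le_trans (ler_norm_dual _ _))// -!mulrA mulrCA ler_wpM2l//.
rewrite (le_trans (gM _ _ _))// ler_wpM2l//.
by rewrite ler_piMr// mulr_ge0.
Qed.

Definition adj3 : btrilinear (dual E) E1 E2 (dual E3) :=
  BTrilinear adj3_linear1 adj3_linear2 adj3_linear3 adj3_bounded.

End adjoint3.

Definition arens2 (K : rcScalarType) (E1 E2 E : normedModType K)
    (m : bbilinear E1 E2 E) :
    bbilinear (dual (dual E1)) (dual (dual E2)) (dual (dual E)) :=
  adj2 (adj2 (adj2 m)).

Definition arens3 (K : rcScalarType) (E1 E2 E3 E : normedModType K)
    (g : btrilinear E1 E2 E3 E) :
    btrilinear (dual (dual E1)) (dual (dual E2)) (dual (dual E3))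
      (dual (dual E)) :=
  adj3 (adj3 (adj3 (adj3 g))).

(* [flip_p g] is the flip usually written with superscript p; the variables
   x, y, z range over the first, second and third argument spaces of [g]. *)
Section flips.
Variables (K : rcScalarType) (E1 E2 E3 E : normedModType K).
Variable g : btrilinear E1 E2 E3 E.

Fact flip_bounded_i : exists M : K, forall y x z,
  `|g x y z| <= M * (`|y| * `|x| * `|z|).
Proof.
have [M gM] := btri_bounded g; exists M => y x z.
by rewrite [`|y| * _]mulrC.
Qed.

Definition flip_i : btrilinear E2 E1 E3 E :=
  @BTrilinear K E2 E1 E3 E (fun y x z => g x y z)
    (fun x z => btri_linear2 g x z) (fun y z => btri_linear1 g y z)
    (fun y x => btri_linear3 g x y) flip_bounded_i.

Fact flip_bounded_j : exists M : K, forall x z y,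
  `|g x y z| <= M * (`|x| * `|z| * `|y|).
Proof.
have [M gM] := btri_bounded g; exists M => x z y.
by rewrite mulrAC.
Qed.

Definition flip_j : btrilinear E1 E3 E2 E :=
  @BTrilinear K E1 E3 E2 E (fun x z y => g x y z)
    (fun z y => btri_linear1 g y z) (fun x y => btri_linear3 g x y)
    (fun x z => btri_linear2 g x z) flip_bounded_j.

Fact flip_bounded_r : exists M : K, forall z y x,
  `|g x y z| <= M * (`|z| * `|y| * `|x|).
Proof.
have [M gM] := btri_bounded g; exists M => z y x.
by rewrite [_ * `|x|]mulrC [`|z| * _]mulrC [`|x| * _]mulrA.
Qed.

Definition flip_r : btrilinear E3 E2 E1 E :=
  @BTrilinear K E3 E2 E1 E (fun z y x => g x y z)
    (fun y x => btri_linear3 g x y) (fun z x => btri_linear2 g x z)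
    (fun z y => btri_linear1 g y z) flip_bounded_r.

Fact flip_bounded_t : exists M : K, forall z x y,
  `|g x y z| <= M * (`|z| * `|x| * `|y|).
Proof.
have [M gM] := btri_bounded g; exists M => z x y.
by rewrite -[`|z| * _ * _]mulrA [`|z| * _]mulrC.
Qed.

Definition flip_t : btrilinear E3 E1 E2 E :=
  @BTrilinear K E3 E1 E2 E (fun z x y => g x y z)
    (fun x y => btri_linear3 g x y) (fun z y => btri_linear1 g y z)
    (fun z x => btri_linear2 g x z) flip_bounded_t.

Fact flip_bounded_s : exists M : K, forall y z x,
  `|g x y z| <= M * (`|y| * `|z| * `|x|).
Proof.
have [M gM] := btri_bounded g; exists M => y z x.
by rewrite [_ * `|x|]mulrC [`|x| * _]mulrA.
Qed.

Definition flip_s : btrilinear E2 E3 E1 E :=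
  @BTrilinear K E2 E3 E1 E (fun y z x => g x y z)
    (fun z x => btri_linear2 g x z) (fun y x => btri_linear3 g x y)
    (fun y z => btri_linear1 g y z) flip_bounded_s.

End flips.

Definition banach_algebra (K : rcScalarType) (A : completeNormedModType K)
    (pi : bbilinear A A A) : Prop :=
  (forall a b c, pi (pi a b) c = pi a (pi b c)) /\
  (forall a b, `|pi a b| <= `|a| * `|b|).

Definition banach_module (K : rcScalarType) (A X : completeNormedModType K)
    (pi : bbilinear A A A) (pi1 : bbilinear A X X) (pi2 : bbilinear X A X) :
    Prop :=
  [/\ forall a b x, pi1 (pi a b) x = pi1 a (pi1 b x),
      forall x a b, pi2 x (pi a b) = pi2 (pi2 x a) b &
      forall a x b, pi1 a (pi2 x b) = pi2 (pi1 a x) b].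

Definition tri_derivation (K : rcScalarType) (A X : normedModType K)
    (pi : bbilinear A A A) (pi1 : bbilinear A X X) (pi2 : bbilinear X A X)
    (D : btrilinear A A A X) : Prop :=
  [/\ forall a b c d, D (pi a d) b c = pi2 (D a b c) d + pi1 a (D d b c),
      forall a b c d, D a (pi b d) c = pi2 (D a b c) d + pi1 b (D a d c) &
      forall a b c d, D a b (pi c d) = pi2 (D a b c) d + pi1 c (D a b d)].

Section phi.
Variables (K : rcScalarType) (A X : normedModType K).
Variables (pi2 : bbilinear X A X) (D : btrilinear A A A X) (a : A).

Definition phi_map (c b d : A) : X := pi2 (D a b c) d.

Fact phi_linear1 b d : linear (fun c => phi_map c b d).
Proof. by move=> k c c'; rewrite /phi_map btri_linear3 linearPl. Qed.

Fact phi_linear2 c d : linear (fun b => phi_map c b d).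
Proof. by move=> k b b'; rewrite /phi_map btri_linear2 linearPl. Qed.

Fact phi_linear3 c b : linear (fun d => phi_map c b d).
Proof. by move=> k d d'; rewrite /phi_map linearPr. Qed.

Fact phi_bounded : exists M : K, forall c b d,
  `|phi_map c b d| <= M * (`|c| * `|b| * `|d|).
Proof.
have [M M0 DM] := btri_bounded0 D; have [N N0 pN] := bbil_bounded0 pi2.
exists (N * (M * `|a|)) => c b d; rewrite (le_trans (pN _ _))//.
rewrite -mulrA ler_wpM2l// mulrA ler_wpM2r// (le_trans (DM _ _ _))//.
by rewrite -!mulrA [`|c| * _]mulrC.
Qed.

Definition phi : btrilinear A A A X :=
  @BTrilinear K A A A X phi_map
    phi_linear1 phi_linear2 phi_linear3 phi_bounded.

End phi.

Section psi.
Variables (K : rcScalarType) (A X : normedModType K).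
Variables (pi1 : bbilinear A X X) (D : btrilinear A A A X) (xs : dual X).

Definition psi_map (a d b : A) : dual A := adj3 D (adj2 pi1 xs b) a d.

Fact psi_linear1 d b : linear (fun a => psi_map a d b).
Proof. by move=> k x y; rewrite /psi_map btri_linear2. Qed.

Fact psi_linear2 a b : linear (fun d => psi_map a d b).
Proof. by move=> k x y; rewrite /psi_map btri_linear3. Qed.

Fact psi_linear3 a d : linear (fun b => psi_map a d b).
Proof. by move=> k x y; rewrite /psi_map linearPr btri_linear1. Qed.

Fact psi_bounded : exists M : K, forall a d b,
  `|psi_map a d b| <= M * (`|a| * `|d| * `|b|).
Proof.
have [M M0 DM] := btri_bounded0 (adj3 D).
have [N N0 pN] := bbil_bounded0 (adj2 pi1).
exists (M * (N * `|xs|)) => a d b; rewrite (le_trans (DM _ _ _))//.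
rewrite -[leRHS]mulrA ler_wpM2l// -mulrA [`|a| * `|d| * `|b|]mulrC.
by rewrite [leRHS]mulrA ler_wpM2r ?mulr_ge0// -[leRHS]mulrA.
Qed.

Definition psi : btrilinear A A A (dual A) :=
  @BTrilinear K A A A (dual A) psi_map
    psi_linear1 psi_linear2 psi_linear3 psi_bounded.

End psi.

(* Main.v *)
Require Import Defs.
From mathcomp Require Import all_boot all_order all_algebra.
From mathcomp Require Import normedtype.

(** Write [F], [G], [H], [L] for elements of the bidual of [A].  Unfolding the
four adjoints, [arens3 g F G H] sends a functional [f] to
  [F (x |-> G (y |-> H (z |-> f (g x y z))))],
an iterated evaluation in which the first argument is the outermost one, and
[arens2] behaves in the same way.  An extension of a map in several variables
is thus determined by the order in which its variables are evaluated, and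
conjugating [arens3] by a flip changes this order and nothing else.

Evaluate the three derivation identities for [arens3 D] at [xs], expand every
product on the left by the identity for [D], and compare the two sides.  In
the first identity the [pi1] terms cancel and in the third the [pi2] terms do;
in the second neither does.  Listing variables from the outermost to the
innermost one, and writing [S] for [xs (pi2 (D a b c) d)], this leaves
- first variable: the orders [a d b c] and [a b c d] agree on [S];
- third variable: the orders [a b c d] and [c a b d] agree on
  [xs (pi1 c (D a b d))], that is, the extension of [psi] agrees with its
  [t]-[s] conjugate;
- second variable: the difference of the orders [a b d c] and [a b c d] on [S]
  is the difference of the orders [b a d c] and [a b d c] on
  [xs (pi1 b (D a d c))].

In the conditions on [S] the variable [a] is outermost, so both sides are [F]
applied to a functional on [A]; they agree for all [F] if and only if they
agree for [F] the evaluation at a point of [A] ([bidual_eval]), and then they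
become the conditions on [phi].  The second identity mixes two conditions.
They separate because, for [F] the evaluation at [a], the orders [b a d c] and
[a b d c] coincide: what remains is the second condition on [phi], and it
holds for every [F] once it holds for points.  Subtracting it from the second
identity leaves the [j]-[j] condition on [psi]. *)

Set Implicit Arguments.
Unset Strict Implicit.
Unset Printing Implicit Defensive.

Import GRing.Theory.
Local Open Scope ring_scope.

Lemma dual_apply_add (K : rcScalarType) (E : normedModType K) (f : dual E)
    (x y z : E) : x = y + z -> f x = f y + f z :> K.
Proof. by move=> ->; rewrite linearD. Qed.

Section bidual.
Variables (K : rcScalarType) (E : normedModType K).

(** Additivity of [F] under a pointwise hypothesis: iterating it splits an
iterated evaluation of a sum without naming the intermediate functionals. *)
Lemma bidual_apply_add (F : dual (dual E)) (f f1 f2 : dual E) :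
  (forall x, f x = f1 x + f2 x :> K) -> F f = F f1 + F f2 :> K.
Proof. by move=> h; apply: dual_apply_add; apply: dualE. Qed.

Fact bidual_eval_bounded (x : E) :
  (fun f : dual E => f x) \in @bounded_functional K (dual E).
Proof.
apply: dualP => [c f g //|]; exists `|x| => f.
by rewrite mulrC ler_norm_dual.
Qed.

Definition bidual_eval (x : E) : dual (dual E) := Dual (bidual_eval_bounded x).

End bidual.

Section extensions.
Variables (K : rcScalarType) (A X : normedModType K).
Variables (pi : bbilinear A A A) (pi1 : bbilinear A X X) (pi2 : bbilinear X A X).
Variable D : btrilinear A A A X.
Implicit Types (a : A) (xs : dual X) (F G H L : dual (dual A)).

(** The extended action on the left evaluates the acting element [H] first,
whereas in [psi] it comes third: hence the flip [t]. *)
Lemma arens2_left_psi F G H L xs :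
  arens2 pi1 H (arens3 D F G L) xs = arens3 (flip_t (psi pi1 D xs)) H F G L.
Proof.
rewrite /=; congr (dual_val H _); apply: dualE => c /=.
congr (dual_val F _); apply: dualE => a /=.
congr (dual_val G _); apply: dualE => b /=.
by congr (dual_val L _); apply: dualE => d.
Qed.

Lemma arens2_right_phi a G H L xs :
  arens2 pi2 (arens3 D (bidual_eval a) G H) L xs
    = arens3 (flip_i (phi pi2 D a)) G H L xs.
Proof.
rewrite /=; congr (dual_val G _); apply: dualE => b /=.
congr (dual_val H _); apply: dualE => c /=.
by congr (dual_val L _); apply: dualE => d.
Qed.

Hypothesis derD : tri_derivation pi pi1 pi2 D.

Lemma arens3_mul1_eval a G H L xs :
  arens3 D (arens2 pi (bidual_eval a) L) G H xs
    = arens3 (flip_r (phi pi2 D a)) L G H xs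
      + arens2 pi1 (bidual_eval a) (arens3 D L G H) xs.
Proof.
have [der1 _ _] := derD; rewrite /=.
apply: bidual_apply_add => d /=; apply: bidual_apply_add => b /=.
apply: bidual_apply_add => c /=; apply: dual_apply_add.
exact: der1.
Qed.

(** Once [a] is a point of [A] it no longer takes part in the order of
evaluation, so that the [pi1] term is already the one of the derivation
identity. *)
Lemma arens3_mul2_eval a G H L xs :
  arens3 D (bidual_eval a) (arens2 pi G L) H xs
    = arens3 (flip_s (phi pi2 D a)) G L H xs
      + arens2 pi1 G (arens3 D (bidual_eval a) L H) xs.
Proof.
have [_ der2 _] := derD; rewrite /=.
apply: bidual_apply_add => b /=; apply: bidual_apply_add => d /=.
apply: bidual_apply_add => c /=; apply: dual_apply_add.
exact: der2.
Qed.

(** The product stands in the innermost variable of [arens3 D], so its two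
factors are evaluated last and no order has to be changed: this gives the
[pi2] term of the derivation identity and the extension of [psi] itself. *)
Lemma arens3_mul3 F G H L xs :
  arens3 D F G (arens2 pi H L) xs
    = arens2 pi2 (arens3 D F G H) L xs + arens3 (psi pi1 D xs) F G H L.
Proof.
have [_ _ der3] := derD; rewrite /=.
apply: bidual_apply_add => a /=; apply: bidual_apply_add => b /=.
apply: bidual_apply_add => c /=; apply: bidual_apply_add => d /=.
by apply: dual_apply_add; exact: der3.
Qed.

(** Both sides are [F] applied to a functional on [A], so it is enough to look
at the points of [A]. *)
Lemma arens3_mul1 G H L xs :
  (forall a, arens3 (flip_r (phi pi2 D a)) L G H xs
               = arens3 (flip_i (phi pi2 D a)) G H L xs) ->
  forall F, arens3 D (arens2 pi F L) G H xs
    = arens2 pi2 (arens3 D F G H) L xs + arens2 pi1 F (arens3 D L G H) xs.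
Proof.
move=> hphi F; rewrite /=; apply: bidual_apply_add => a.
have := arens3_mul1_eval a G H L xs.
by rewrite hphi -arens2_right_phi.
Qed.

(** With the condition on [phi], the [pi2] term of the expansion may be put in
the order of evaluation of the derivation identity; the [pi1] term keeps the
order that the product prescribes. *)
Lemma arens3_mul2 G H L xs :
  (forall a, arens3 (flip_i (phi pi2 D a)) G H L xs
               = arens3 (flip_s (phi pi2 D a)) G L H xs) ->
  forall F, arens3 D F (arens2 pi G L) H xs
    = arens2 pi2 (arens3 D F G H) L xs
      + arens3 (flip_j (psi pi1 D xs)) F G L H.
Proof.
move=> hphi F; rewrite /=; apply: bidual_apply_add => a.
apply: etrans (arens3_mul2_eval a G H L xs) _.
rewrite -hphi -arens2_right_phi /=; congr (_ + _).
congr (dual_val G _); apply: dualE => b /=.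
congr (dual_val L _); apply: dualE => d /=.
by congr (dual_val H _); apply: dualE => c.
Qed.

End extensions.

Theorem theorem8 (K : rcScalarType) (A X : completeNormedModType K)
    (pi : bbilinear A A A) (pi1 : bbilinear A X X) (pi2 : bbilinear X A X)
    (D : btrilinear A A A X) :
  banach_algebra pi -> banach_module pi pi1 pi2 ->
  tri_derivation pi pi1 pi2 D ->
  (tri_derivation (arens2 pi) (arens2 pi1) (arens2 pi2) (arens3 D) <->
   (forall a : A,
      flip_r (arens3 (flip_r (phi pi2 D a)))
        = flip_i (arens3 (flip_i (phi pi2 D a))) /\
      flip_i (arens3 (flip_i (phi pi2 D a)))
        = flip_t (arens3 (flip_s (phi pi2 D a)))) /\
   (forall xs : dual X,
      flip_j (arens3 (flip_j (psi pi1 D xs)))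
        = flip_s (arens3 (flip_t (psi pi1 D xs))) /\
      flip_s (arens3 (flip_t (psi pi1 D xs)))
        = arens3 (psi pi1 D xs))).
Proof.
move=> _ _ derD; split=> [[der1 der2 der3]|[hphi hpsi]].
  (* At a point of A the pi1 terms of the second identity cancel. *)
  have phi_is a G H L xs : arens3 (flip_i (phi pi2 D a)) G H L xs
      = arens3 (flip_s (phi pi2 D a)) G L H xs.
    apply: (addIr (arens2 pi1 G (arens3 D (bidual_eval a) L H) xs)).
    by rewrite -(arens3_mul2_eval derD) der2 -arens2_right_phi.
  split=> [a|xs]; split; apply: btrilinearP.
  - move=> H G L; apply: dualE => xs.
    apply: (addIr (arens2 pi1 (bidual_eval a) (arens3 D L G H) xs)).
    rewrite -[LHS](arens3_mul1_eval derD) der1.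
    by congr (_ + _); exact: arens2_right_phi.
  - by move=> H G L; apply: dualE => xs; exact: phi_is.
  - move=> F L G; apply: dualE => H.
    apply: (addrI (arens2 pi2 (arens3 D F G H) L xs)).
    rewrite -[LHS](arens3_mul2 derD (fun a => phi_is a G H L xs)) der2.
    by congr (_ + _); exact: arens2_left_psi.
  - move=> F G H; apply: dualE => L.
    apply: (addrI (arens2 pi2 (arens3 D F G H) L xs)).
    rewrite -[RHS](arens3_mul3 derD) der3.
    by congr (_ + _); rewrite -[LHS]arens2_left_psi.
have phi_ri a G H L xs : arens3 (flip_r (phi pi2 D a)) L G H xs
    = arens3 (flip_i (phi pi2 D a)) G H L xs.
  exact: (congr1 (fun g => dual_val (btri_map g H G L) xs) (hphi a).1).
have phi_is a G H L xs : arens3 (flip_i (phi pi2 D a)) G H L xs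
    = arens3 (flip_s (phi pi2 D a)) G L H xs.
  exact: (congr1 (fun g => dual_val (btri_map g H G L) xs) (hphi a).2).
have psi_jt xs F G L H : arens3 (flip_j (psi pi1 D xs)) F G L H
    = arens3 (flip_t (psi pi1 D xs)) G F L H.
  exact: (congr1 (fun g => dual_val (btri_map g F L G) H) (hpsi xs).1).
have psi_t xs F G H L : arens3 (psi pi1 D xs) F G H L
    = arens3 (flip_t (psi pi1 D xs)) H F G L.
  exact/esym/(congr1 (fun g => dual_val (btri_map g F G H) L) (hpsi xs).2).
split=> F G H L; apply: dualE => xs.
- by rewrite (arens3_mul1 derD) // => a; exact: phi_ri.
- by rewrite (arens3_mul2 derD) ?psi_jt -?arens2_left_psi // => a; exact: phi_is.
- by rewrite (arens3_mul3 derD) psi_t -arens2_left_psi.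
Qed.
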